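(* Let $u:[t_0,t_1]\to U_h^{\rm grad}$ and $\rho,s,\varsigma:[t_0,t_1]\to V_h$ be smooth curves, put $T=-\pi_h\frac{\delta\ell}{\delta s}\in V_h$, assumed positive on every closed element, and suppose that the spatially discrete entropy equation $$\langle\partial_ts,Tw\rangle+b_h(\pi_h(Tw),s,u)-d_h(1,T,\pi_h(Tw))=c(w,u,u)-d_h(w,T,T)-e_h(w,T),\quad\forall w\in V_h,$$ holds, together with the relation defining the internal entropy $\varsigma$, $$\langle\bar D_t^h(\varsigma-s),f\rangle=-d_h(1,T,f),\quad\forall f\in V_h,$$ where $(d_h,e_h)$ is one of the three pairs given in the context (homogeneous Neumann, Dirichlet, nonhomogeneous Neumann). Then $$\langle\bar D_t^h\varsigma,Tw\rangle=\langle\bar D_t^hs,Tw\rangle-d_h(1,T,Tw)\ge0$$ for all $w\in DG_0(\mathcal T_h)$ with $w\ge0$, where in the Dirichlet and nonhomogeneous Neumann cases $w$ is in addition required to have compact support in the (open) domain $\Omega$. In particular $\int_KT\,\bar D_t^h\varsigma\,dx\ge0$ for each $K\in\mathcal T_h$ (provided $K$ is away from $\partial\Omega$, i.e. $K\cap\partial\Omega=\emptyset$, in the Dirichlet and nonhomogeneous Neumann cases).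
   Context: Mesh and spaces. $\Omega\subset\mathbb R^d$, $d\in\{2,3\}$, is a bounded domain that is exactly triangulated by a conforming simplicial triangulation $\mathcal T_h$; $\mathcal E_h^0$ and $\mathcal E_h^\partial$ are the sets of interior and boundary codimension-1 faces, $h_e$ is the diameter of the face $e$. $DG_q(\mathcal T_h)=\{f\in L^2(\Omega):f|_K\in P_q(K)\ \forall K\}$ ($P_q$ = polynomials of degree $\le q$), $V_h=DG_q(\mathcal T_h)$, $U_h^{\rm grad}=\{u\in H_0^1(\Omega)^d:u|_K\in P_r(K)^d\ \forall K\}$, $1\le r\le q$. $\langle\cdot,\cdot\rangle$ is the $L^2(\Omega)$ inner product and $\pi_h:L^2(\Omega)\to V_h$ the $L^2$-orthogonal projector. On $e=K_1\cap K_2\in\mathcal E_h^0$: $\llbracket f\rrbracket=f_1n_1+f_2n_2$, $\{f\}=\frac12(f_1+f_2)$, with $f_i=f|_{K_i}$ and $n_i$ the unit normal to $e$ pointing outward from $K_i$ ($\{\cdot\}$ is componentwise for vector fields); $n$ is the outward unit normal on $\partial\Omega$. $\ell(u,\rho,s)$ is a given fluid Lagrangian with functional derivative $\frac{\delta\ell}{\delta s}$ taken with respect to the $L^2$ pairing, evaluated at $(u,\rho,s)$. Forms. $b_h(f,\rho,u)=-\sum_{K}\int_K(u\cdot\nabla f)\rho\,dx+\sum_{e\in\mathcal E_h^0}\int_eu\cdot\llbracket f\rrbracket\{\rho\}\,da$. For a density $\rho(t)\in V_h$, $\bar D_t^h\rho\in V_h$ is defined by $\langle\bar D_t^h\rho,f\rangle=\langle\partial_t\rho,f\rangle+b_h(f,\rho,u)$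 for all $f\in V_h$. $c(w,u,v)=\int_\Omega w\,\sigma(u):\nabla v\,dx$ with $\sigma(u)=2\mu\,\mathrm{Def}\,u+\lambda(\mathrm{div}\,u)\delta$, $\mathrm{Def}\,u=\frac12(\nabla u+\nabla u^{\mathsf T})$, $\delta$ the identity tensor, with constants $\mu\ge0$, $\lambda+\frac2d\mu\ge0$. With constant heat conductivity $\kappa\ge0$ and penalty parameter $\eta>0$ set $$d_h^N(w,f,g)=-\sum_{K}\int_K\frac wf\kappa\nabla f\cdot\nabla g\,dx+\sum_{e\in\mathcal E_h^0}\int_e\frac1{\{f\}}\{w\kappa\nabla f\}\cdot\llbracket g\rrbracket\,da-\sum_{e\in\mathcal E_h^0}\int_e\frac1{\{f\}}\{w\kappa\nabla g\}\cdot\llbracket f\rrbracket\,da-\sum_{e\in\mathcal E_h^0}\frac\eta{h_e}\int_e\frac{\{w\}}{\{f\}}\llbracket f\rrbracket\cdot\llbracket g\rrbracket\,da .$$ The pair $(d_h,e_h)$ is one of the following. (i) Homogeneous Neumann: $d_h=d_h^N$, $e_h=0$. (ii) Dirichlet, with prescribed boundary temperature $T_0:\partial\Omega\to\mathbb R$: $$d_h(w,f,g)=d_h^N(w,f,g)-\sum_{e\in\mathcal E_h^\partial}\int_e\frac wf\kappa\nabla g\cdot n\,(f-T_0)\,da+\sum_{e\in\mathcal E_h^\partial}\int_e\frac wf\kappa\nabla f\cdot n\,g\,da,$$ $$e_h(w,f)=-\int_{\partial\Omega}\frac wf\kappa\nabla f\cdot n\,T_0\,da+\sum_{e\in\mathcal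 E_h^\partial}\frac\eta{h_e}\int_ew(f-T_0)\,da .$$ (iii) Nonhomogeneous Neumann, with prescribed boundary heat flux $q_0$ on $\partial\Omega$ (possibly depending on the boundary temperature $f$): $$d_h(w,f,g)=d_h^N(w,f,g)+\sum_{e\in\mathcal E_h^\partial}\int_e\frac wf\kappa\nabla f\cdot n\,g\,da,\qquad e_h(w,f)=\int_{\partial\Omega}w\,q_0\,da .$$ *)

(* Defs.v *)
From HB Require Import structures.
From mathcomp Require Import all_boot all_order all_algebra.
From mathcomp Require Import -(notations) mpoly.
From mathcomp Require Import all_classical all_reals all_analysis.

Set Implicit Arguments.
Unset Strict Implicit.
Unset Printing Implicit Defensive.

Import Order.TTheory GRing.Theory Num.Theory.
Import numFieldNormedType.Exports.

Local Open Scope classical_set_scope.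
Local Open Scope ring_scope.

Section lebesgue_tuple.
Context {R : realType}.
Notation Rk k := (k.-tuple (measurableTypeR R)).

Definition tuple_cons k (p : measurableTypeR R * Rk k) : Rk k.+1 :=
  [the k.+1.-tuple (measurableTypeR R) of p.1 :: p.2].

Lemma measurable_tuple_cons k : measurable_fun [set: _] (@tuple_cons k).
Proof. exact: measurable_cons measurable_fst measurable_snd. Qed.

Section step.
Variables (k : nat) (m : {sigma_finite_measure set (Rk k) -> \bar R}).

Definition lebesgue_step : set (Rk k.+1) -> \bar R :=
  pushforward (lebesgue_measure \x m)%E (@tuple_cons k).

Let pushed : {measure set (Rk k.+1) -> \bar R} :=
  measure_function_pushforward__canonical__measure_function_Measure
    (lebesgue_measure \x m)%E (@measurable_tuple_cons k).

Let step0 : lebesgue_step set0 = 0%E.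
Proof. exact: (measure0 pushed). Qed.

Let step_ge0 A : (0 <= lebesgue_step A)%E.
Proof. exact: (measure_ge0 pushed). Qed.

Let step_sigma_additive : semi_sigma_additive lebesgue_step.
Proof. exact: (@measure_semi_sigma_additive _ _ _ pushed). Qed.

HB.instance Definition _ := isMeasure.Build _ _ _ lebesgue_step
  step0 step_ge0 step_sigma_additive.

Let uncons (x : Rk k.+1) : measurableTypeR R * Rk k :=
  (tnth x ord0, [tuple of behead x]).

Let unconsK : cancel uncons (@tuple_cons k).
Proof. by move=> x; rewrite /tuple_cons /= [RHS]tuple_eta; apply/val_inj. Qed.

Let consK : cancel (@tuple_cons k) uncons.
Proof. by move=> [a b]; congr pair; apply/val_inj. Qed.

Let step_sigma_finite : sigma_finite setT lebesgue_step.
Proof.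
have /sigma_finiteP[F [FT ndF Foo]] := sigma_finiteT (@lebesgue_measure R).
have /sigma_finiteP[G [GT ndG Goo]] := sigma_finiteT m.
exists (fun i => uncons @^-1` (F i `*` G i)).
  rewrite -preimage_bigcup; apply/esym/seteqP; split => // x _.
  have [i _ Fi] : (\bigcup_i F i) (uncons x).1 by rewrite -FT.
  have [j _ Gj] : (\bigcup_i G i) (uncons x).2 by rewrite -GT.
  exists (maxn i j) => //; split.
    by move: Fi; exact/subsetPset/ndF/leq_maxl.
  by move: Gj; exact/subsetPset/ndG/leq_maxr.
move=> i; have [mF Fi] := Foo i; have [mG Gi] := Goo i; split.
  rewrite -[X in measurable X]setTI.
  suff muncons : measurable_fun setT uncons by apply: muncons => //; exact: measurableX.
  apply: measurable_fun_pair; first exact: measurable_tnth.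
  exact: measurable_behead.
rewrite /lebesgue_step /pushforward -comp_preimage.
rewrite (_ : uncons \o _ = id); last by apply/funext => p; exact: consK.
by rewrite preimage_id product_measure1E// lte_mul_pinfty// ge0_fin_numE.
Qed.

HB.instance Definition _ := Measure_isSigmaFinite.Build _ _ _ lebesgue_step
  step_sigma_finite.
End step.

Fixpoint lebesgue_tuple k : {sigma_finite_measure set (Rk k) -> \bar R} :=
  match k with
  | 0 => \d_([tuple] : Rk 0)
  | k'.+1 => lebesgue_step (lebesgue_tuple k')
  end.

(* The measure of a box, which characterizes Lebesgue measure. *)
Lemma lebesgue_tuple_box k (A : 'I_k -> set (measurableTypeR R)) :
  (forall i, measurable (A i)) ->
  lebesgue_tuple k [set x | forall i, A i (tnth x i)] =
  (\prod_(i < k) lebesgue_measure (A i))%E.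
Proof.
elim: k A => [|k IHk] A mA.
  rewrite big_ord0 /= diracE (_ : [set x | _] = setT) ?in_setT//.
  by apply/seteqP; split => // x _ [].
rewrite big_ord_recl -IHk//= /lebesgue_step /pushforward.
rewrite -product_measure1E//; last first.
  rewrite (_ : [set x | _] = \bigcap_(i in [set: 'I_k])
      ((@tnth _ (measurableTypeR R))^~ i @^-1` A (lift ord0 i))).
    apply: fin_bigcap_measurable; first exact: finite_finset.
    by move=> i _; rewrite -[X in measurable X]setTI; exact: measurable_tnth.
  by apply/seteqP; split => x /= H i; [move=> _|]; exact: H.
congr (product_measure1 _ _ _); apply/seteqP; split => -[a b] /= H.
  split=> [|i] /=; first by have := H ord0.
  by have := H (lift ord0 i); rewrite tnthS.
move=> i; case: (unliftP ord0 i) => [j|] ->; last exact: H.1.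
by rewrite tnthS; apply: H.2.
Qed.
End lebesgue_tuple.

Section euclidean.
Context {R : realType}.

Definition dot k (x y : 'rV[R]_k) : R := (x *m y^T) 0 0.

(* The library norm on row vectors is the sup norm. *)
Definition enorm k (x : 'rV[R]_k) : R := Num.sqrt (dot x x).

Definition diameter k (A : set 'rV[R]_k) : R :=
  sup [set enorm (p.1 - p.2) | p in A `*` A].

Definition contract k (A B : 'M[R]_k) : R := \sum_a \sum_b A a b * B a b.

Definition row_of_tuple k (x : k.-tuple (measurableTypeR R)) : 'rV[R]_k :=
  \row_a tnth x a.

Definition integral_on k (A : set 'rV[R]_k) (f : 'rV[R]_k -> R) : R :=
  \int[lebesgue_tuple k]_(x in @row_of_tuple k @^-1` A) f (row_of_tuple x).

Definition std_simplex k : set 'rV[R]_k :=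
  [set t | (forall a, 0 <= t 0 a) /\ \sum_a t 0 a <= 1].

(* Integral with respect to surface measure over the simplex with vertices
   [a ord0, ..., a ord_max], parametrized affinely by the standard simplex;
   the Jacobian is the square root of the Gram determinant of its edges. *)
Definition surface_integral k (a : 'I_k.+1 -> 'rV[R]_k.+1)
    (f : 'rV[R]_k.+1 -> R) : R :=
  let E : 'M[R]_(k, k.+1) := \matrix_(m < k) (a (lift ord0 m) - a ord0) in
  Num.sqrt (\det (E *m E^T)) *
  integral_on (@std_simplex k) (fun t => f (a ord0 + t *m E)).

End euclidean.

Section mesh.
Context {R : realType} {n : nat}.
Notation d := n.+1.

Definition subsimplex (v : 'I_d.+1 -> 'rV[R]_d) (A : pred 'I_d.+1) :
    set 'rV[R]_d :=
  [set x | exists l : 'I_d.+1 -> R,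
    [/\ forall k, 0 <= l k, forall k, ~~ A k -> l k = 0,
        \sum_k l k = 1 & x = \sum_k l k *: v k]].

Record mesh := Mesh {
  nelt : nat;
  vtx : 'I_nelt -> 'I_d.+1 -> 'rV[R]_d;
  vtx_affine_free : forall i,
    (\matrix_(k < d) (vtx i (lift ord0 k) - vtx i ord0)) \in unitmx;
  (* Distinct elements meet in a common proper face, which may be empty. *)
  mesh_conforming : forall i j, i != j -> exists A B : pred 'I_d.+1,
    [/\ exists k, ~~ A k, exists k, ~~ B k,
        subsimplex (vtx i) predT `&` subsimplex (vtx j) predT
          = subsimplex (vtx i) A &
        subsimplex (vtx i) A = subsimplex (vtx j) B] }.

Variable M : mesh.

Definition elt (i : 'I_(nelt M)) : set 'rV[R]_d := subsimplex (vtx i) predT.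

(* [(i, k)] is the facet of element [i] opposite to its vertex [k]. *)
Definition facet_index := ('I_(nelt M) * 'I_d.+1)%type.

Definition facet (F : facet_index) : set 'rV[R]_d :=
  subsimplex (vtx F.1) (predC1 F.2).

Definition facet_integral (F : facet_index) (f : 'rV[R]_d -> R) : R :=
  surface_integral (fun m => vtx F.1 (lift F.2 m)) f.

Definition normal (F : facet_index) : 'rV[R]_d :=
  xget 0 [set nu : 'rV[R]_d | [/\ enorm nu = 1,
    forall l m, l != F.2 -> m != F.2 ->
      dot nu (vtx F.1 l - vtx F.1 m) = 0 &
    forall m, m != F.2 -> dot nu (vtx F.1 F.2 - vtx F.1 m) < 0]].

(* The boundary, as [Om] is open. *)
Definition bdry (Om : set 'rV[R]_d) : set 'rV[R]_d := closure Om `\` Om.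

Definition boundary_facet (Om : set 'rV[R]_d) (F : facet_index) : bool :=
  `[< facet F `<=` bdry Om >].

Definition triangulates (Om : set 'rV[R]_d) : Prop :=
  closure Om = \bigcup_(i in [set: 'I_(nelt M)]) elt i /\
  bdry Om = \bigcup_(F in [set F | boundary_facet Om F]) facet F.

(* An interior face [e = K_1 \cap K_2] is the pair of its two descriptions as
   a facet of [K_1] and of [K_2]; ordering them counts each face once. The last
   condition only matters for a cracked domain, where a facet shared by two
   elements can lie on the boundary. *)
Definition face_index := (facet_index * facet_index)%type.

Definition interior_face (Om : set 'rV[R]_d) (e : face_index) : bool :=
  [&& (e.1.1 < e.2.1)%N, `[< facet e.1 = facet e.2 >] &
      ~~ boundary_facet Om e.1].

(* A function (class in L^2) which is polynomial on each element is given by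
   its polynomials; as elements have nonempty interior they are unique. Traces
   on facets are then values of these polynomials. *)
Definition broken := 'I_(nelt M) -> mpoly d R.
Definition broken_vec := 'I_(nelt M) -> 'I_d -> mpoly d R.

Definition pval (p : mpoly d R) (x : 'rV[R]_d) : R := meval (fun a => x 0 a) p.

Definition grad (p : mpoly d R) (x : 'rV[R]_d) : 'rV[R]_d :=
  \row_a pval (mderiv a p) x.

Definition vec_val (u : 'I_d -> mpoly d R) (x : 'rV[R]_d) : 'rV[R]_d :=
  \row_a pval (u a) x.

Definition jacobian (u : 'I_d -> mpoly d R) (x : 'rV[R]_d) : 'M[R]_d :=
  \matrix_(a, b) pval (mderiv b (u a)) x.

Definition DG (q : nat) (f : broken) : Prop :=
  forall i, (msize (f i) <= q.+1)%N.

Definition cst1 : broken := fun=> 1.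
Definition mulb (f g : broken) : broken := fun i => f i * g i.
Definition subb (f g : broken) : broken := fun i => f i - g i.
Definition oppb (f : broken) : broken := fun i => - f i.

Definition to_fun (f : broken) (x : 'rV[R]_d) : R :=
  \sum_i pval (f i) x * \1_((elt i)°) x.

Definition vec_to_fun (u : broken_vec) (x : 'rV[R]_d) : 'rV[R]_d :=
  \row_a to_fun (fun i => u i a) x.

(* L^2 pairing of two functions, each given by its restrictions to the
   elements. *)
Definition pair_restr (f g : 'I_(nelt M) -> 'rV[R]_d -> R) : R :=
  \sum_i integral_on (elt i) (fun x => f i x * g i x).

Definition ip (f g : broken) : R :=
  pair_restr (fun i => pval (f i)) (fun i => pval (g i)).

(* [p] is the L^2-orthogonal projection on [DG q] of the function with
   restrictions [f]. *)
Definition is_proj (q : nat) (f : 'I_(nelt M) -> 'rV[R]_d -> R)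
    (p : broken) : Prop :=
  DG q p /\ forall v, DG q v -> ip p v = pair_restr f (fun i => pval (v i)).

Definition nonneg (w : broken) : Prop :=
  forall i x, elt i x -> 0 <= pval (w i) x.

Definition support (w : broken) : set 'rV[R]_d :=
  closure [set x | exists2 i, elt i x & pval (w i) x != 0].

Definition compactly_supported (Om : set 'rV[R]_d) (w : broken) : Prop :=
  compact (support w) /\ support w `<=` Om.

Definition jump (e : face_index) (f : broken) (x : 'rV[R]_d) : 'rV[R]_d :=
  pval (f e.1.1) x *: normal e.1 + pval (f e.2.1) x *: normal e.2.

Definition avg (e : face_index) (f : broken) (x : 'rV[R]_d) : R :=
  (pval (f e.1.1) x + pval (f e.2.1) x) / 2.

Definition avg_vec (e : face_index) (F : 'I_(nelt M) -> 'rV[R]_d) : 'rV[R]_d :=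
  2^-1 *: (F e.1.1 + F e.2.1).

End mesh.

Arguments mesh : clear implicits.
Arguments elt {R n M} i _.
Arguments DG {R n M} q f.
Arguments cst1 {R n M} _.
Arguments mulb {R n M} f g _.
Arguments subb {R n M} f g _.
Arguments oppb {R n M} f _.
Arguments to_fun {R n M} f x.
Arguments vec_to_fun {R n M} u x.
Arguments pair_restr {R n M} f g.
Arguments ip {R n M} f g.
Arguments is_proj {R n M} q f p.
Arguments nonneg {R n M} w.
Arguments support {R n M} w _.
Arguments compactly_supported {R n M} Om w.
Arguments jump {R n M} e f x.
Arguments avg {R n M} e f x.
Arguments avg_vec {R n M} e F.

Section spaces.
Context {R : realType} {n : nat}.
Notation d := n.+1.
Variable Om : set 'rV[R]_d.

Definition is_domain : Prop :=
  [/\ open Om, connected Om, Om !=set0 & bounded_set Om].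

(* Representatives are taken measurable on the whole space. *)
Definition L2 (f : 'rV[R]_d -> R) : Prop :=
  measurable_fun setT (f \o @row_of_tuple R d) /\
  (\int[lebesgue_tuple d]_(x in @row_of_tuple R d @^-1` Om)
     ((f (row_of_tuple x)) ^+ 2)%:E < +oo)%E.

Definition partial (a : 'I_d) (f : 'rV[R]_d -> R) (x : 'rV[R]_d) : R :=
  'D_(delta_mx 0 a) f x.

Definition test_function (phi : 'rV[R]_d -> R) : Prop :=
  [/\ forall s : seq 'I_d, continuous (foldr partial phi s) /\
        forall a x, derivable (foldr partial phi s) x (delta_mx 0 a),
      compact (closure [set x | phi x != 0]) &
      closure [set x | phi x != 0] `<=` Om].

(* [f] is the limit in H^1 of test functions; the [g a] are then its weak
   partial derivatives. *)
Definition H10 (f : 'rV[R]_d -> R) : Prop :=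
  L2 f /\ exists (phi : nat -> 'rV[R]_d -> R) (g : 'I_d -> 'rV[R]_d -> R),
    [/\ forall k, test_function (phi k), forall a, L2 (g a),
        integral_on Om (fun x => (phi k x - f x) ^+ 2) @[k --> \oo] --> 0 &
        forall a, integral_on Om (fun x => (partial a (phi k) x - g a x) ^+ 2)
          @[k --> \oo] --> 0].

Definition Ugrad {M : mesh R n} (r : nat) (u : broken_vec M) : Prop :=
  forall a, DG r (fun i => u i a) /\ H10 (to_fun (fun i => u i a)).

(* [g] is the derivative of [ell u rho] at [s] with respect to the L^2 pairing,
   tested against bounded variations of [s]. *)
Definition is_functional_derivative
    (ell : ('rV[R]_d -> 'rV[R]_d) -> ('rV[R]_d -> R) -> ('rV[R]_d -> R) -> R)
    (u : 'rV[R]_d -> 'rV[R]_d) (rho s g : 'rV[R]_d -> R) : Prop :=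
  L2 g /\ forall ds : 'rV[R]_d -> R,
    measurable_fun setT (ds \o @row_of_tuple R d) ->
    (exists C, forall x, `|ds x| <= C) ->
    is_derive (0 : R) 1 (fun eps : R => ell u rho (fun x => s x + eps * ds x))
      (integral_on Om (fun x => g x * ds x)).

End spaces.

Section curves.
Context {R : realType}.
Variables t0 t1 : R.

Definition diff_quot (f : R -> R) (t t' : R) : R := (f t' - f t) / (t' - t).

(* Derivative relative to the interval, hence one-sided at its end points. *)
Definition dt (f : R -> R) (t : R) : R :=
  lim (diff_quot f t @ within `[t0, t1] t^').

Definition smooth (f : R -> R) : Prop :=
  forall k t, t \in `[t0, t1] ->
    cvg (diff_quot (iter k dt f) t @ within `[t0, t1] t^').

Context {n : nat} {M : mesh R n}.

Definition smooth_broken (f : R -> broken M) : Prop :=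
  forall i m, smooth (fun t => mcoeff m (f t i)).

Definition smooth_vec (u : R -> broken_vec M) : Prop :=
  forall i a m, smooth (fun t => mcoeff m (u t i a)).

(* Time derivative of a curve in [DG q], coefficient by coefficient. *)
Definition dt_broken (q : nat) (f : R -> broken M) (t : R) : broken M :=
  fun i => \sum_(m : bmultinom n.+1 q.+1)
    dt (fun t' => mcoeff m (f t' i)) t *: mpolyX R m.

End curves.

Inductive boundary_condition (R : realType) (n : nat) (M : mesh R n) :=
| HomNeumann
| Dirichlet of ('rV[R]_n.+1 -> R)
  (* The prescribed flux may depend on the temperature. *)
| Neumann of (broken M -> 'rV[R]_n.+1 -> R).

Arguments HomNeumann {R n M}.

Section forms.
Context {R : realType} {n : nat}.
Notation d := n.+1.
Context (Om : set 'rV[R]_d) {M : mesh R n}.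
Implicit Types (w f g rho : broken M) (u v : broken_vec M).

(* Fields of [Ugrad] have the same trace from both sides of an interior face,
   so the average is that common trace. *)
Definition trace_vec (e : face_index M) u (x : 'rV[R]_d) : 'rV[R]_d :=
  avg_vec e (fun i => vec_val (u i) x).

Definition b_h f rho u : R :=
  - (\sum_i integral_on (elt i)
       (fun x => dot (vec_val (u i) x) (grad (f i) x) * pval (rho i) x))
  + \sum_(e | interior_face Om e) facet_integral e.1
       (fun x => dot (trace_vec e u x) (jump e f x) * avg e rho x).

Definition is_Dbar (q : nat) (t0 t1 : R) (u : R -> broken_vec M)
    (rho : R -> broken M) (t : R) (D : broken M) : Prop :=
  DG q D /\ forall f, DG q f ->
    ip D f = ip (dt_broken t0 t1 q rho t) f + b_h f (rho t) (u t).

Definition Def_tensor (u : 'I_d -> mpoly d R) (x : 'rV[R]_d) : 'M[R]_d :=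
  2^-1 *: (jacobian u x + (jacobian u x)^T).

Definition stress (mu lam : R) (u : 'I_d -> mpoly d R) (x : 'rV[R]_d) :
    'M[R]_d :=
  (2 * mu) *: Def_tensor u x + (lam * \tr (jacobian u x)) *: 1%:M.

Definition c_form (mu lam : R) w u v : R :=
  \sum_i integral_on (elt i)
    (fun x => pval (w i) x * contract (stress mu lam (u i) x) (jacobian (v i) x)).

Variables (kappa eta : R).

Definition d_hN w f g : R :=
  - (\sum_i integral_on (elt i)
       (fun x => pval (w i) x / pval (f i) x * kappa
                 * dot (grad (f i) x) (grad (g i) x)))
  + (\sum_(e | interior_face Om e) facet_integral e.1
       (fun x => (avg e f x)^-1 *
          dot (avg_vec e (fun i => (pval (w i) x * kappa) *: grad (f i) x))
              (jump e g x)))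
  - (\sum_(e | interior_face Om e) facet_integral e.1
       (fun x => (avg e f x)^-1 *
          dot (avg_vec e (fun i => (pval (w i) x * kappa) *: grad (g i) x))
              (jump e f x)))
  - \sum_(e | interior_face Om e) eta / diameter (facet e.1) *
       facet_integral e.1
         (fun x => avg e w x / avg e f x * dot (jump e f x) (jump e g x)).

Definition boundary_sum (F : facet_index M -> 'rV[R]_d -> R) : R :=
  \sum_(e | boundary_facet Om e) facet_integral e (F e).

Definition d_h (bc : boundary_condition M) w f g : R :=
  match bc with
  | HomNeumann => d_hN w f g
  | Dirichlet T0 => d_hN w f g
      - boundary_sum (fun e x => pval (w e.1) x / pval (f e.1) x * kappa
          * dot (grad (g e.1) x) (normal e) * (pval (f e.1) x - T0 x))
      + boundary_sum (fun e x => pval (w e.1) x / pval (f e.1) x * kappa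
          * dot (grad (f e.1) x) (normal e) * pval (g e.1) x)
  | Neumann _ => d_hN w f g
      + boundary_sum (fun e x => pval (w e.1) x / pval (f e.1) x * kappa
          * dot (grad (f e.1) x) (normal e) * pval (g e.1) x)
  end.

Definition e_h (bc : boundary_condition M) w f : R :=
  match bc with
  | HomNeumann => 0
  | Dirichlet T0 =>
      - boundary_sum (fun e x => pval (w e.1) x / pval (f e.1) x * kappa
          * dot (grad (f e.1) x) (normal e) * T0 x)
      + \sum_(e | boundary_facet Om e) eta / diameter (facet e) *
          facet_integral e (fun x => pval (w e.1) x * (pval (f e.1) x - T0 x))
  | Neumann q0 => boundary_sum (fun e x => pval (w e.1) x * q0 f x)
  end.

Definition is_hom_neumann (bc : boundary_condition M) : bool :=
  if bc is HomNeumann then true else false.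

End forms.

(* Main.v *)
(** As [w] is constant on each element, [T w] lies in [V_h] and is its own
    projection, so it can be used both in the entropy equation tested with [w] and
    in the relation defining the internal entropy. By linearity of the time
    derivative and of [b_h] in the density, the latter gives the identity; the
    former turns the right-hand side into [c(w,u,u) - d_h(w,T,T) - e_h(w,T)]. Here
    [c(w,u,u) >= 0] by the conditions on [mu] and [lam], and in [d_h(w,T,T)] the
    two consistency terms cancel, leaving minus two nonnegative dissipation terms.
    All boundary contributions vanish when [w] vanishes on the boundary facets,
    which is all that the support condition is used for. *)

Require Import Defs.
From HB Require Import structures.
From mathcomp Require Import all_boot all_order all_algebra.
From mathcomp Require Import -(notations) mpoly.
From mathcomp Require Import all_classical all_reals all_analysis.
From mathcomp Require Import ring lra.
Import Order.TTheory GRing.Theory Num.Theory.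
Import numFieldNormedType.Exports.

Local Open Scope classical_set_scope.
Local Open Scope ring_scope.

Set Implicit Arguments.
Unset Strict Implicit.
Unset Printing Implicit Defensive.

(** * Integrable integrands and splitting of integrals *)

Section tame.
Context {R : realType}.

(* A class of integrands closed under sums, products and affine substitution,
   hence containing every polynomial integrand on elements and facets, and
   integrable on bounded measurable domains. *)
Definition tame k (f : 'rV[R]_k -> R) : Prop :=
  measurable_fun setT (f \o @row_of_tuple R k) /\
  forall B : R, exists C : R, forall x : 'rV[R]_k, (forall a, `|x 0 a| <= B) -> `|f x| <= C.

Lemma tame_cst k c : tame (fun _ : 'rV[R]_k => c).
Proof. by split=> [|B]; [exact: measurable_cst|by exists `|c|]. Qed.

Lemma tame_coord k a : tame (fun x : 'rV[R]_k => x 0 a).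
Proof.
split=> [|B]; last by exists B => x xB; exact: xB.
rewrite (_ : _ \o _ = (@tnth k R)^~ a); first exact: measurable_tnth.
by apply/funext => x /=; rewrite mxE.
Qed.

Lemma tameD k (f g : 'rV[R]_k -> R) :
  tame f -> tame g -> tame (fun x => f x + g x).
Proof.
move=> [mf bf] [mg bg]; split=> [|B]; first exact: measurable_realfun.measurable_funD.
have [C fC] := bf B; have [D gD] := bg B.
exists (C + D) => x xB; apply: (le_trans (ler_normD _ _)).
by rewrite lerD ?fC ?gD.
Qed.

Lemma tameM k (f g : 'rV[R]_k -> R) :
  tame f -> tame g -> tame (fun x => f x * g x).
Proof.
move=> [mf bf] [mg bg]; split=> [|B]; first exact: measurable_realfun.measurable_funM.
have [C fC] := bf B; have [D gD] := bg B.
by exists (C * D) => x xB; rewrite normrM ler_pM ?fC ?gD.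
Qed.

Lemma tame_sum k (I : Type) (r : seq I) (F : I -> 'rV[R]_k -> R) :
  (forall i, tame (F i)) -> tame (fun x => \sum_(i <- r) F i x).
Proof.
move=> tF; elim: r => [|i r IHr].
  by under eq_fun do rewrite big_nil; exact: tame_cst.
by under eq_fun do rewrite big_cons; exact: tameD.
Qed.

Lemma tame_prod k (I : Type) (r : seq I) (F : I -> 'rV[R]_k -> R) :
  (forall i, tame (F i)) -> tame (fun x => \prod_(i <- r) F i x).
Proof.
move=> tF; elim: r => [|i r IHr].
  by under eq_fun do rewrite big_nil; exact: tame_cst.
by under eq_fun do rewrite big_cons; exact: tameM.
Qed.

Lemma tameX k (f : 'rV[R]_k -> R) m : tame f -> tame (fun x => f x ^+ m).
Proof.
move=> tf; elim: m => [|m IHm].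
  by under eq_fun do rewrite expr0; exact: tame_cst.
by under eq_fun do rewrite exprS; exact: tameM.
Qed.

Definition tame_map k n (g : 'rV[R]_k -> 'rV[R]_n) : Prop :=
  forall a, tame (fun x => g x 0 a).

Lemma tame_map_affine k n (b : 'rV[R]_n) (E : 'M[R]_(k, n)) (c : 'rV[R]_k) :
  tame_map (fun t => b + (t - c) *m E).
Proof.
move=> a; under eq_fun do rewrite !mxE.
apply: tameD; first exact: tame_cst.
apply: tame_sum => i; under eq_fun do rewrite !mxE.
apply: tameM; last exact: tame_cst.
by apply: tameD; [exact: tame_coord|exact: tame_cst].
Qed.

Lemma tame_pval k n (p : mpoly n.+1 R) (g : 'rV[R]_k -> 'rV[R]_n.+1) :
  tame_map g -> tame (fun t => pval p (g t)).
Proof.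
move=> tg; under eq_fun do rewrite /pval mevalE.
apply: tame_sum => m; apply: tameM; first exact: tame_cst.
by apply: tame_prod => i; apply: tameX; exact: tg.
Qed.

Lemma tame_dot k n (g h : 'rV[R]_k -> 'rV[R]_n) :
  tame_map g -> tame_map h -> tame (fun t => dot (g t) (h t)).
Proof.
move=> tg th; under eq_fun do rewrite /dot mxE.
by apply: tame_sum => i; under eq_fun do rewrite mxE; exact: tameM.
Qed.

Definition tame_domain k (A : set 'rV[R]_k) : Prop :=
  measurable (@row_of_tuple R k @^-1` A) /\
  exists B : R, forall x, A x -> forall a, `|x 0 a| <= B.

Lemma measurable_tame_ge0 k (f : 'rV[R]_k -> R) :
  tame f -> measurable (@row_of_tuple R k @^-1` [set x | 0 <= f x]).
Proof.
move=> [mf _]; have := mf measurableT `[0, +oo[%classic (measurable_itv _).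
rewrite setTI; congr measurable; apply/seteqP.
by split => x /=; rewrite in_itv /= andbT.
Qed.

(** A tame function is bounded on [A], and the measurable set [A] has finite measure because it lies
    in the box of side [[-B, B]]. *)
Lemma tame_integrable k (A : set 'rV[R]_k) (f : 'rV[R]_k -> R) :
  tame_domain A -> tame f ->
  (lebesgue_tuple k).-integrable (@row_of_tuple R k @^-1` A)
    (EFin \o (fun x => f (row_of_tuple x))).
Proof.
move=> [mA [B AB]] [mf bf]; apply: measurable_bounded_integrable => //.
- pose box := [set x : k.-tuple (measurableTypeR R) | forall i, `[-B, B]%classic (tnth x i)].
  have mbox : measurable box.
    rewrite (_ : box = \bigcap_(i in [set: 'I_k])
      ((@tnth _ (measurableTypeR R))^~ i @^-1` `[-B, B]%classic)).
      apply: fin_bigcap_measurable; first exact: finite_finset.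
      move=> i _; rewrite -[X in measurable X]setTI.
      by apply: measurable_tnth => //; exact: measurable_itv.
    by apply/seteqP; split => x /= H i; [move=> _|]; exact: H.
  apply: (@le_lt_trans _ _ (lebesgue_tuple k box)).
    apply: le_measure; rewrite ?inE// => x /AB xB i.
    by rewrite /= in_itv /= -ler_norml; have := xB i; rewrite mxE.
  rewrite (@lebesgue_tuple_box R k (fun=> `[-B, B]%classic)); last first.
    by move=> i; exact: measurable_itv.
  rewrite ltey_eq; apply/orP; left.
  elim/big_ind : _ => // [x y|i _]; first exact: fin_numM.
  by rewrite lebesgue_measure_itv; case: ifP.
- exact: measurable_funTS.
- have [C fC] := bf B.
  by exists C; split; [exact: num_real|move=> D CD x /AB xB /=; apply/(le_trans (fC _ xB))/ltW].
Qed.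

Lemma integral_onB k (A : set 'rV[R]_k) (f g : 'rV[R]_k -> R) :
  tame_domain A -> tame f -> tame g ->
  integral_on A (fun x => f x - g x) = integral_on A f - integral_on A g.
Proof.
by move=> tA tf tg; rewrite /integral_on RintegralB//; [exact: tA.1|exact: tame_integrable..].
Qed.

Lemma integral_on_ge0 k (A : set 'rV[R]_k) (f : 'rV[R]_k -> R) :
  (forall x, A x -> 0 <= f x) -> 0 <= integral_on A f.
Proof. by move=> f0; apply: Rintegral_ge0 => x; exact: f0. Qed.

Lemma eq_integral_on k (A : set 'rV[R]_k) (f g : 'rV[R]_k -> R) :
  (forall x, A x -> f x = g x) -> integral_on A f = integral_on A g.
Proof. by move=> fg; apply: eq_Rintegral => x; rewrite inE => /fg. Qed.

Lemma integral_on_eq0 k (A : set 'rV[R]_k) (f : 'rV[R]_k -> R) :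
  (forall x, A x -> f x = 0) -> integral_on A f = 0.
Proof.
move=> f0; rewrite (@eq_integral_on _ _ _ (fun=> 0)) //.
by rewrite /integral_on /Rintegral integral0.
Qed.

(** The preimage is cut out by finitely many inequalities between tame functions, hence measurable.
    Boundedness is assumed separately, since [g] may collapse directions. *)
Lemma tame_domain_simplex k n (g : 'rV[R]_n -> 'rV[R]_k) :
  tame_map g -> (exists B : R, forall x, std_simplex (g x) -> forall a, `|x 0 a| <= B) ->
  tame_domain [set x | std_simplex (g x)].
Proof.
move=> tg bg; split=> //.
(* The last inequality is written with [1 + -1 *] so that the closure of tame functions under sums
   and products applies. *)
rewrite (_ : _ @^-1` _ =
    (\bigcap_(a in [set: 'I_k]) (@row_of_tuple R n @^-1` [set x | 0 <= g x 0 a]))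
    `&` (@row_of_tuple R n @^-1` [set x | 0 <= 1 + -1 * \sum_a g x 0 a])).
  apply: measurableI.
    apply: fin_bigcap_measurable; first exact: finite_finset.
    by move=> a _; apply: measurable_tame_ge0; exact: tg.
  apply: measurable_tame_ge0; apply: tameD; first exact: tame_cst.
  by apply: tameM; [exact: tame_cst|exact: tame_sum].
apply/seteqP; split => x /=; rewrite mulN1r subr_ge0 => -[g0 g1]; split=> // a.
  by move=> _; exact: g0.
exact: (g0 a I).
Qed.

Lemma std_simplex_le1 k (t : 'rV[R]_k) : std_simplex t -> forall a, `|t 0 a| <= 1.
Proof.
move=> [t0 t1] a; rewrite ger0_norm//; apply: le_trans t1.
by rewrite (bigD1 a)//= lerDl sumr_ge0.
Qed.

Lemma tame_domain_std_simplex k : tame_domain (@std_simplex R k).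
Proof.
apply: (@tame_domain_simplex k k id); first by move=> a; exact: tame_coord.
by exists 1; exact: std_simplex_le1.
Qed.

End tame.

(** * Affine parametrization of simplices and integrals over them *)

Section simplices.
Context {R : realType}.

Definition edges k n (a : 'I_k.+1 -> 'rV[R]_n) : 'M[R]_(k, n) :=
  \matrix_(m < k) (a (lift ord0 m) - a ord0).

Lemma barycentric_edges k n (a : 'I_k.+1 -> 'rV[R]_n) (l : 'I_k.+1 -> R) :
  \sum_m l m = 1 ->
  \sum_m l m *: a m = a ord0 + (\row_m l (lift ord0 m)) *m edges a.
Proof.
rewrite big_ord_recl => l1.
rewrite mulmx_sum_row big_ord_recl (_ : l ord0 = 1 - \sum_(i < k) l (lift ord0 i)).
  rewrite scalerBl scale1r -addrA; congr (_ + _).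
  rewrite scaler_suml addrC -sumrB; apply: eq_bigr => i _.
  by rewrite rowK mxE scalerBr.
by rewrite -l1 addrK.
Qed.

(** The coordinates of [t] weight all vertices but [a ord0], which receives the remainder
    [1 - \sum_j t 0 j]. *)
Lemma std_simplex_barycentric k n (a : 'I_k.+1 -> 'rV[R]_n) (t : 'rV[R]_k) :
  std_simplex t -> exists l : 'I_k.+1 -> R,
  [/\ forall m, 0 <= l m, \sum_m l m = 1 &
      a ord0 + t *m edges a = \sum_m l m *: a m].
Proof.
move=> [t0 t1].
pose l m := if unlift ord0 m is Some j then t 0 j else 1 - \sum_j t 0 j.
have l0 : l ord0 = 1 - \sum_j t 0 j by rewrite /l unlift_none.
have lS j : l (lift ord0 j) = t 0 j by rewrite /l liftK.
have l1 : \sum_m l m = 1.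
  by rewrite big_ord_recl l0 (eq_bigr _ (fun j _ => lS j)) subrK.
exists l; split=> //.
  move=> m; rewrite /l; case: unliftP => [j|] _; first exact: t0.
  by rewrite subr_ge0.
rewrite barycentric_edges//; congr (_ + _ *m _).
by apply/rowP => j; rewrite mxE lS.
Qed.

(* [(x - v ord0) *m invmx (edges v)] collects the barycentric coordinates of [x]
   other than the one at [v ord0]; the [0 +] matches [tame_map_affine]. *)
Lemma subsimplexT_preimage n (v : 'I_n.+2 -> 'rV[R]_n.+1) :
  edges v \in unitmx ->
  subsimplex v predT
    = [set x | std_simplex (0 + (x - v ord0) *m invmx (edges v))].
Proof.
move=> uE; apply/seteqP; split=> x /=.
  move=> [l [l0 _ l1 ->]]; rewrite barycentric_edges// addrAC subrr !add0r mulmxK//.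
  split=> [a|]; first by rewrite mxE.
  rewrite -l1 [leRHS]big_ord_recl ler_wpDl//.
  by under eq_bigr do rewrite mxE.
rewrite add0r => /(std_simplex_barycentric v)[l [l0 l1]].
by rewrite mulmxKV// addrC subrK => ->; exists l.
Qed.

Lemma tame_domain_subsimplexT n (v : 'I_n.+2 -> 'rV[R]_n.+1) :
  edges v \in unitmx -> tame_domain (subsimplex v predT).
Proof.
move=> uE; rewrite subsimplexT_preimage//; apply: tame_domain_simplex.
  exact: tame_map_affine.
(* The map from barycentric coordinates back to points is bounded on the cube of side [[-1, 1]], one
   coordinate at a time; summing the bounds gives a constant common to all coordinates. *)
have tg := tame_map_affine (v ord0) (edges v) 0.
have [C gC] := choice (fun a => (tg a).2 1).
exists (\sum_a `|C a|) => x /std_simplex_le1 x1 a.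
have := gC a _ x1.
rewrite add0r subr0 mulmxKV// addrC subrK => /le_trans; apply.
by rewrite (bigD1 a)//= (le_trans (ler_norm _))// lerDl sumr_ge0.
Qed.

Lemma surface_integral_ge0 k (a : 'I_k.+1 -> 'rV[R]_k.+1) (f : 'rV[R]_k.+1 -> R) :
  (forall t, std_simplex t -> 0 <= f (a ord0 + t *m edges a)) ->
  0 <= surface_integral a f.
Proof. by move=> f0; rewrite mulr_ge0 ?sqrtr_ge0// integral_on_ge0. Qed.

Lemma surface_integral_eq0 k (a : 'I_k.+1 -> 'rV[R]_k.+1) (f : 'rV[R]_k.+1 -> R) :
  (forall t, std_simplex t -> f (a ord0 + t *m edges a) = 0) ->
  surface_integral a f = 0.
Proof. by move=> f0; rewrite /surface_integral integral_on_eq0 ?mulr0. Qed.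

Lemma surface_integralB k (a : 'I_k.+1 -> 'rV[R]_k.+1) (f g : 'rV[R]_k.+1 -> R) :
  tame (fun t => f (a ord0 + t *m edges a)) ->
  tame (fun t => g (a ord0 + t *m edges a)) ->
  surface_integral a (fun x => f x - g x)
    = surface_integral a f - surface_integral a g.
Proof.
move=> tf tg; rewrite /surface_integral integral_onB ?mulrBr//.
exact: tame_domain_std_simplex.
Qed.

Lemma dot_ge0 k (x : 'rV[R]_k) : 0 <= dot x x.
Proof.
by rewrite /dot mxE sumr_ge0// => i _; rewrite mxE -expr2 sqr_ge0.
Qed.

(** [sup] defaults to [0] on a set without supremum; otherwise it dominates some Euclidean norm. *)
Lemma diameter_ge0 k (A : set 'rV[R]_k) : 0 <= diameter A.
Proof.
rewrite /diameter; set D := [set _ | _ in _].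
have [supD|/sup_out->//] := pselect (has_sup D).
have [_ [p Ap _]] := supD.1.
apply: (le_trans (sqrtr_ge0 (dot (p.1 - p.2) (p.1 - p.2)))).
by apply: (ub_le_sup supD.2); exists p.
Qed.

End simplices.

(** * Linearity of the pairing and of [b_h] on broken polynomials *)

Section broken_functions.
Context {R : realType} {n : nat} {M : mesh R n}.
Implicit Types (f g w rho : broken M) (u : broken_vec M).

Lemma tame_domain_elt (i : 'I_(nelt M)) : tame_domain (elt i).
Proof. by apply: tame_domain_subsimplexT; exact: vtx_affine_free. Qed.

Lemma pvalB (p p' : mpoly n.+1 R) x : pval (p - p') x = pval p x - pval p' x.
Proof. exact: mevalB. Qed.

Lemma pvalM (p p' : mpoly n.+1 R) x : pval (p * p') x = pval p x * pval p' x.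
Proof. exact: mevalM. Qed.

Lemma facet_sub_elt (F : facet_index M) : facet F `<=` elt F.1.
Proof. by move=> x [l [l0 _ l1 ->]]; exists l. Qed.

(** The parametrization through which [facet_integral] integrates. *)
Definition facet_point (F : facet_index M) (t : 'rV[R]_n) : 'rV[R]_n.+1 :=
  let a m := vtx F.1 (lift F.2 m) in a ord0 + t *m edges a.

(** The weights extend by [0] at the vertex opposite to the facet. *)
Lemma facet_point_in (F : facet_index M) t :
  std_simplex t -> facet F (facet_point F t).
Proof.
move=> /(std_simplex_barycentric (fun m => vtx F.1 (lift F.2 m)))[l [l0 l1 lE]].
rewrite /facet_point lE.
pose l' m := if unlift F.2 m is Some j then l j else 0.
have l'F : l' F.2 = 0 by rewrite /l' unlift_none.
have l'S j : l' (lift F.2 j) = l j by rewrite /l' liftK.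
exists l'; split.
- by move=> m; rewrite /l'; case: unliftP.
- by move=> m /=; rewrite negbK => /eqP ->.
- rewrite (@bigD1_ord _ _ _ _ F.2)//= l'F add0r -l1.
  by apply: eq_bigr => j _; rewrite l'S.
- rewrite (@bigD1_ord _ _ _ _ F.2)//= l'F scale0r add0r.
  by apply: eq_bigr => j _; rewrite l'S.
Qed.

Lemma tame_map_facet_point (F : facet_index M) : tame_map (facet_point F).
Proof.
move=> a; have := tame_map_affine (vtx F.1 (lift F.2 ord0))
  (edges (fun m => vtx F.1 (lift F.2 m))) 0 a.
by under eq_fun do rewrite subr0.
Qed.

Lemma facet_integral_ge0 (F : facet_index M) (f : 'rV[R]_n.+1 -> R) :
  (forall x, facet F x -> 0 <= f x) -> 0 <= facet_integral F f.
Proof.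
by move=> f0; apply: surface_integral_ge0 => t /facet_point_in/f0.
Qed.

Lemma facet_integral_eq0 (F : facet_index M) (f : 'rV[R]_n.+1 -> R) :
  (forall x, facet F x -> f x = 0) -> facet_integral F f = 0.
Proof.
by move=> f0; apply: surface_integral_eq0 => t /facet_point_in/f0.
Qed.

Lemma ipBl f g w : ip (subb f g) w = ip f w - ip g w.
Proof.
rewrite /ip /pair_restr -sumrB; apply: eq_bigr => i _.
have tp p : tame (pval p : 'rV[R]_n.+1 -> R).
  by apply: (@tame_pval _ _ _ _ id) => a; exact: tame_coord.
rewrite -integral_onB; [|exact: tame_domain_elt|exact: tameM..].
by congr integral_on; apply/funext => x; rewrite pvalB mulrBl.
Qed.

(** Splitting each integral requires integrability, so the integrands are shown tame, on facets
    after composition with [facet_point]. *)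
Lemma b_hB (Om : set 'rV[R]_n.+1) f rho1 rho2 u :
  b_h Om f (subb rho1 rho2) u = b_h Om f rho1 u - b_h Om f rho2 u.
Proof.
have tid : tame_map (@id 'rV[R]_n.+1) by move=> a; exact: tame_coord.
have tvec k (x : 'rV[R]_k -> 'rV[R]_n.+1) (v : 'I_n.+1 -> mpoly n.+1 R) :
    tame_map x -> tame_map (fun t => vec_val v (x t)).
  by move=> tx a; under eq_fun do rewrite mxE; exact: tame_pval.
have tD k (g h : 'rV[R]_k -> 'rV[R]_n.+1) :
    tame_map g -> tame_map h -> tame_map (fun t => g t + h t).
  by move=> tg th a; under eq_fun do rewrite mxE; exact: tameD.
have tZ k (c : 'rV[R]_k -> R) (h : 'rV[R]_k -> 'rV[R]_n.+1) :
    tame c -> tame_map h -> tame_map (fun t => c t *: h t).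
  by move=> tc th a; under eq_fun do rewrite mxE; exact: tameM.
have tc k (v : 'rV[R]_n.+1) : tame_map (fun _ : 'rV[R]_k => v).
  by move=> a; exact: tame_cst.
rewrite /b_h opprD addrACA -opprD -!sumrB; congr (- _ + _).
  apply: eq_bigr => i _.
  rewrite -integral_onB; first last.
  - by apply: tameM; [apply: tame_dot; exact: tvec|exact: (tame_pval _ tid)].
  - by apply: tameM; [apply: tame_dot; exact: tvec|exact: (tame_pval _ tid)].
  - exact: tame_domain_elt.
  by congr integral_on; apply/funext => x; rewrite pvalB mulrBr.
apply: eq_bigr => e _.
have tx := @tame_map_facet_point e.1.
have tI rho : tame (fun t => let x := facet_point e.1 t in
    dot (trace_vec e u x) (jump e f x) * avg e rho x).
  apply: tameM.
    apply: tame_dot.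
      by apply: tZ; [exact: tame_cst|apply: tD; exact: tvec].
    by apply: tD; apply: tZ; (exact: tame_pval || exact: tc).
  by apply: tameM; [apply: tameD; exact: tame_pval|exact: tame_cst].
rewrite /facet_integral -surface_integralB; [|exact: tI..].
congr surface_integral; apply/funext => x.
by rewrite -mulrBr /avg !pvalB; congr (_ * _); ring.
Qed.

End broken_functions.

(** * Nonnegativity of the viscous dissipation density *)

Section stress.
Context {R : realType}.

(** Cauchy-Schwarz against the constant vector, obtained by expanding the sum of squared deviations
    from the mean [m]. *)
Lemma sqr_sum_le_card n (x : 'I_n.+1 -> R) :
  (\sum_a x a) ^+ 2 / n.+1%:R <= \sum_a x a ^+ 2.
Proof.
set S := \sum_a x a; set m := S / n.+1%:R.
have mS : m * n.+1%:R = S by rewrite divfK// pnatr_eq0.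
have : 0 <= \sum_a (x a - m) ^+ 2 by apply: sumr_ge0 => a _; exact: sqr_ge0.
have -> : \sum_a (x a - m) ^+ 2 = \sum_a x a ^+ 2 - 2 * m * S + m ^+ 2 * n.+1%:R.
  have -> : m ^+ 2 * n.+1%:R = \sum_(a < n.+1) m ^+ 2.
    by rewrite sumr_const card_ord mulr_natr.
  rewrite /S mulr_sumr -sumrB -big_split; apply: eq_bigr => a _ /=; ring.
have -> : S ^+ 2 / n.+1%:R = m * S by rewrite /m; ring.
have -> : m ^+ 2 * n.+1%:R = m * S by rewrite -[in RHS]mS; ring.
lra.
Qed.

(* Decomposing off the trace: the contraction is at least
   [(lam + 2 mu / d) (\tr J)^2]. *)
Lemma contract_stress_ge0 n (mu lam : R) (J : 'M[R]_n.+1) :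
  0 <= mu -> 0 <= lam + 2 / n.+1%:R * mu ->
  0 <= Defs.contract ((2 * mu) *: (2^-1 *: (J + J^T)) + (lam * \tr J) *: 1%:M) J.
Proof.
move=> mu0 lam0; rewrite /Defs.contract.
have -> : \sum_a \sum_b ((2 * mu) *: (2^-1 *: (J + J^T))
      + (lam * \tr J) *: 1%:M) a b * J a b
    = mu * (\sum_a \sum_b (J a b + J b a) * J a b) + lam * (\tr J) ^+ 2.
  have -> : lam * (\tr J) ^+ 2 = \sum_a lam * \tr J * J a a.
    by rewrite expr2 mulrA -mulr_sumr.
  set c := lam * \tr J; rewrite mulr_sumr -big_split.
  apply: eq_bigr => a _ /=; rewrite mulr_sumr.
  (* Spreading the diagonal term over [b] with a Kronecker delta allows a comparison entry by
     entry. *)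
  rewrite (_ : c * J a a = \sum_b c * (a == b)%:R * J a b).
    by rewrite -big_split; apply: eq_bigr => b _ /=; rewrite !mxE; field.
  rewrite (bigD1 a)//= eqxx mulr1 big1 ?addr0// => b /negPf.
  by rewrite eq_sym => ->; rewrite mulr0 mul0r.
(* Exchanging indices turns the sum into half the sum of the squares [(J a b + J b a) ^+ 2], of
   which only the diagonal ones are kept. *)
have Dge : 2 * \sum_a J a a ^+ 2 <= \sum_a \sum_b (J a b + J b a) * J a b.
  have -> : \sum_a \sum_b (J a b + J b a) * J a b
      = 2^-1 * \sum_a \sum_b (J a b + J b a) ^+ 2.
    have -> : \sum_a \sum_b (J a b + J b a) ^+ 2
        = \sum_a \sum_b (J a b + J b a) * J a b
          + \sum_a \sum_b (J a b + J b a) * J a b.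
      rewrite [X in _ = _ + X]exchange_big -big_split; apply: eq_bigr => a _ /=.
      by rewrite -big_split; apply: eq_bigr => b _ /=; ring.
    by field.
  rewrite !mulr_sumr; apply: ler_sum => a _; rewrite (bigD1 a)//= mulrDr.
  rewrite (_ : 2^-1 * (J a a + J a a) ^+ 2 = 2 * J a a ^+ 2); last by field.
  by rewrite lerDl mulr_ge0// sumr_ge0// => b _; exact: sqr_ge0.
have tr := sqr_sum_le_card (fun a => J a a).
apply: (@le_trans _ _ ((lam + 2 / n.+1%:R * mu) * (\tr J) ^+ 2)).
  by rewrite mulr_ge0// sqr_ge0.
rewrite mulrDl addrC lerD2r (_ : _ * _ = mu * (2 * ((\tr J) ^+ 2 / n.+1%:R))).
  by apply: ler_wpM2l => //; apply: le_trans Dge; apply: ler_wpM2l.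
ring.
Qed.

End stress.

(** * Linearity of the time derivative on a closed interval *)

Section time_derivative.
Context {R : realType}.
Variables t0 t1 : R.
Hypothesis t01 : t0 < t1.

(** Makes limits of difference quotients unique. As [t0 < t1], each point of the interval, end
    points included, is a limit of other points of it. *)
Lemma within_itv_dnbhs_proper t : t \in `[t0, t1] ->
  ProperFilter (within `[t0, t1] t^').
Proof.
rewrite in_itv /= => /andP[t0t tt1]; apply: Build_ProperFilter.
rewrite /within /= => -[e /= e0 eP].
have near x : `|t - x| < e -> x != t -> t0 <= x <= t1 -> False.
  by move=> xe xt xt01; apply: (eP x xe xt); rewrite /= in_itv.
(* The nearby point is taken to the right of [t] if [t < t1] and to the left otherwise; the minimum
   keeps it within distance [e] and inside the interval. *)
have [tt1'|] := ltP t t1.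
  have h0 : 0 < Num.min (e / 2) (t1 - t) by rewrite lt_min divr_gt0//= subr_gt0.
  have he : Num.min (e / 2) (t1 - t) <= e / 2 by rewrite ge_min lexx.
  have ht : Num.min (e / 2) (t1 - t) <= t1 - t by rewrite ge_min lexx orbT.
  set h := Num.min _ _ in h0 he ht.
  apply: (near (t + h)); last lra.
    by rewrite ltr_norml; lra.
  by rewrite gt_eqF//; lra.
move=> t1t.
have h0 : 0 < Num.min (e / 2) (t1 - t0) by rewrite lt_min divr_gt0//= subr_gt0.
have he : Num.min (e / 2) (t1 - t0) <= e / 2 by rewrite ge_min lexx.
have ht : Num.min (e / 2) (t1 - t0) <= t1 - t0 by rewrite ge_min lexx orbT.
set h := Num.min _ _ in h0 he ht.
apply: (near (t - h)); last lra.
  by rewrite ltr_norml; lra.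
by rewrite lt_eqF//; lra.
Qed.

Lemma dtB (f g : R -> R) t : t \in `[t0, t1] ->
  smooth t0 t1 f -> smooth t0 t1 g ->
  dt t0 t1 (fun t' => f t' - g t') t = dt t0 t1 f t - dt t0 t1 g t.
Proof.
move=> tI sf sg; have F := within_itv_dnbhs_proper tI.
(* Smoothness at order [0] is convergence of the first difference quotient. *)
have cf : cvg (diff_quot f t @ within `[t0, t1] t^') := sf 0 t tI.
have cg : cvg (diff_quot g t @ within `[t0, t1] t^') := sg 0 t tI.
rewrite /dt (_ : diff_quot _ t = (diff_quot f t - diff_quot g t)%R).
  by apply: cvg_lim => //; exact: cvgB.
by apply/funext => t' /=; rewrite /diff_quot !fctE; ring.
Qed.

Lemma dt_brokenB n (M : mesh R n) q (f g : R -> broken M) t :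
  t \in `[t0, t1] -> smooth_broken t0 t1 f -> smooth_broken t0 t1 g ->
  dt_broken t0 t1 q (fun t' => subb (f t') (g t')) t
    = subb (dt_broken t0 t1 q f t) (dt_broken t0 t1 q g t).
Proof.
move=> tI sf sg; apply/funext => i; rewrite /subb /dt_broken -sumrB.
apply: eq_bigr => m _; rewrite -scalerBl -dtB//; congr (dt _ _ _ _ *: _).
by apply/funext => t'; rewrite mcoeffB.
Qed.

End time_derivative.

(** * Degree bounds for the test functions *)

Section degrees.
Context {R : realType} {n : nat} {M : mesh R n}.
Implicit Types (f w : broken M).

(** Needed because [T] is minus a projection, so the degree bound is given for [oppb T]. *)
Lemma DG_opp q f : DG q (oppb f) -> DG q f.
Proof. by move=> fq i; have := fq i; rewrite /oppb msizeN. Qed.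

(** A factor of degree [0] acts on each element as a scalar. *)
Lemma DG_mul_DG0 q f w : DG q f -> DG 0 w -> DG q (mulb f w).
Proof.
move=> fq w0 i; rewrite /mulb (msize1_polyC (w0 i)) mulrC mul_mpolyC.
exact: leq_trans (msizeZ_le _ _) (fq i).
Qed.

Lemma DG0_leq q w : DG 0 w -> DG q w.
Proof. by move=> w0 i; apply: leq_trans (w0 i) _. Qed.

End degrees.

(** * Signs of the viscous and thermal terms *)

Section dissipation.
Context {R : realType} {n : nat} {M : mesh R n}.
Variables (Om : set 'rV[R]_n.+1) (kappa eta : R).
Hypotheses (kappa0 : 0 <= kappa) (eta0 : 0 < eta).
Implicit Types (f w : broken M) (u : broken_vec M).

Lemma c_form_ge0 mu lam w u :
  0 <= mu -> 0 <= lam + 2 / n.+1%:R * mu -> nonneg w ->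
  0 <= c_form mu lam w u u.
Proof.
move=> mu0 lam0 w0; apply: sumr_ge0 => i _; apply: integral_on_ge0 => x ix.
by rewrite mulr_ge0 ?contract_stress_ge0// w0.
Qed.

Lemma d_hN_le0 w f :
  nonneg w -> (forall i x, elt i x -> 0 < pval (f i) x) ->
  d_hN Om kappa eta w f f <= 0.
Proof.
(* [addrK] removes the two consistency terms, which coincide when the last two arguments are
   equal. *)
move=> w0 f0; rewrite /d_hN addrK -opprD oppr_le0; apply: addr_ge0.
  apply: sumr_ge0 => i _; apply: integral_on_ge0 => x ix.
  by rewrite mulr_ge0 ?dot_ge0// mulr_ge0// divr_ge0 ?w0// ltW// f0.
apply: sumr_ge0 => e /and3P[_ /asboolP e12 _].
rewrite mulr_ge0//; first by rewrite divr_ge0 ?diameter_ge0// ltW.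
apply: facet_integral_ge0 => x ex.
(* A face lies in both adjacent elements, so the signs of [w] and [f] on either side pass to their
   averages. *)
have x1 := facet_sub_elt ex.
have x2 : elt e.2.1 x by apply: facet_sub_elt; rewrite -e12.
rewrite mulr_ge0 ?dot_ge0// divr_ge0// divr_ge0//.
  by rewrite addr_ge0// w0.
by rewrite addr_ge0// ltW// f0.
Qed.

(** Every boundary integrand carries the factor [w], so all three cases reduce to [d_hN_le0]. *)
Lemma d_h_add_e_h_le0 (bc : boundary_condition M) w f :
  nonneg w -> (forall i x, elt i x -> 0 < pval (f i) x) ->
  (~~ is_hom_neumann bc ->
     forall F, boundary_facet Om F -> forall x, facet F x -> pval (w F.1) x = 0) ->
  d_h Om kappa eta bc w f f + e_h Om kappa eta bc w f <= 0.
Proof.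
move=> w0 f0 wb; have dN := d_hN_le0 w0 f0.
have bsum0 G : ~~ is_hom_neumann bc ->
    (forall F x, pval (w F.1) x = 0 -> G F x = 0) -> boundary_sum Om G = 0.
  move=> /wb {}wb G0; apply: big1 => F /wb wF; apply: facet_integral_eq0 => x Fx.
  by rewrite G0// wF.
case: bc wb bsum0 => [|T0|q0] wb bsum0 /=; first by rewrite addr0.
  rewrite !bsum0 ?oppr0 ?addr0 ?add0r//; try by move=> F x ->; rewrite !mul0r.
  (* The penalty sum has a weight for each facet outside the integral, so it is not a [boundary_sum]
     and is treated facet by facet. *)
  rewrite [X in _ + X]big1 ?addr0// => F /(wb isT) wF.
  by rewrite facet_integral_eq0 ?mulr0// => x Fx; rewrite wF// mul0r.
by rewrite !bsum0 ?addr0//; move=> F x ->; rewrite !mul0r.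
Qed.

End dissipation.

(** Used with [a], [b] the time derivative and transport terms of [sigma], and [c], [d] those of
    [s]. *)
Lemma addrBACA_KC (V : zmodType) (a b c d : V) :
  c + d + (a - c + (b - d)) = a + b.
Proof. by rewrite addrACA !subrKC. Qed.

(** A point where [w] is nonzero is in the support, hence in [Om], which [bdry Om] excludes. *)
Lemma compactly_supported_eq0_bdry (R : realType) (n : nat) (M : mesh R n)
    (Om : set 'rV[R]_n.+1) (w : broken M) (F : facet_index M) x :
  compactly_supported Om w -> boundary_facet Om F -> facet F x ->
  pval (w F.1) x = 0.
Proof.
move=> [_ wOm] /asboolP Fbd Fx; apply/eqP/negPn/negP => wx.
have [_] := Fbd _ Fx; apply; apply: wOm; apply: subset_closure.
by exists F.1 => //; exact: facet_sub_elt.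
Qed.


(** * Localization to a single element *)

Section indicator.
Context {R : realType} {n : nat} {M : mesh R n}.

Definition indicator (i : 'I_(nelt M)) : broken M := fun j => (j == i)%:R.

Lemma pval_indicator i j x : pval (indicator i j) x = (j == i)%:R.
Proof. by rewrite /pval /indicator rmorph_nat. Qed.

Lemma DG0_indicator i : DG 0 (indicator i).
Proof. by move=> j; rewrite /indicator -mpolyC_nat msizeC; case: eqP. Qed.

Lemma ip_mulb_indicator (f g : broken M) i :
  ip f (mulb g (indicator i))
    = integral_on (elt i) (fun x => pval (f i) x * pval (g i) x).
Proof.
rewrite /ip /pair_restr (bigD1 i)//= [X in _ + X]big1 ?addr0.
  apply: eq_integral_on => x _.
  by rewrite pvalM pval_indicator eqxx mulr1.
move=> j /negPf ji; apply: integral_on_eq0 => x _.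
by rewrite pvalM pval_indicator ji !mulr0.
Qed.

End indicator.

(** * Assembly of the identity and the two inequalities *)

Theorem mainTheorem4 (R : realType) (n : nat) (hd : n.+1 = 2%N \/ n.+1 = 3%N)
  (Om : set 'rV[R]_n.+1) (hOm : is_domain Om)
  (M : mesh R n) (hM : triangulates M Om)
  (r q : nat) (hr : (1 <= r)%N) (hrq : (r <= q)%N)
  (mu lam kappa eta : R)
  (hmu : 0 <= mu) (hlam : 0 <= lam + 2 / n.+1%:R * mu)
  (hkappa : 0 <= kappa) (heta : 0 < eta)
  (bc : boundary_condition M)
  (ell : ('rV[R]_n.+1 -> 'rV[R]_n.+1) -> ('rV[R]_n.+1 -> R) ->
         ('rV[R]_n.+1 -> R) -> R)
  (t0 t1 : R) (ht : t0 < t1)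
  (u : R -> broken_vec M) (rho s sigma T : R -> broken M)
  (hu : forall t, t \in `[t0, t1] -> Ugrad Om r (u t))
  (hrho : forall t, t \in `[t0, t1] -> DG q (rho t))
  (hs : forall t, t \in `[t0, t1] -> DG q (s t))
  (hsigma : forall t, t \in `[t0, t1] -> DG q (sigma t))
  (hu_smooth : smooth_vec t0 t1 u)
  (hrho_smooth : smooth_broken t0 t1 rho)
  (hs_smooth : smooth_broken t0 t1 s)
  (hsigma_smooth : smooth_broken t0 t1 sigma)
  (* temperature: T = - pi_h (delta ell / delta s) *)
  (dlds : R -> 'rV[R]_n.+1 -> R)
  (hdlds : forall t, t \in `[t0, t1] ->
     is_functional_derivative Om ell (vec_to_fun (u t)) (to_fun (rho t))
       (to_fun (s t)) (dlds t))
  (hT : forall t, t \in `[t0, t1] ->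
     is_proj q (fun _ => dlds t) (oppb (T t)))
  (hTpos : forall t, t \in `[t0, t1] ->
     forall i x, elt i x -> 0 < pval (T t i) x)
  (* discrete entropy equation, P being pi_h (T w) *)
  (hentropy : forall t, t \in `[t0, t1] -> forall w, DG q w ->
     forall P, is_proj q (fun i => pval (mulb (T t) w i)) P ->
     ip (dt_broken t0 t1 q s t) (mulb (T t) w) + b_h Om P (s t) (u t)
       - d_h Om kappa eta bc cst1 (T t) P
     = c_form mu lam w (u t) (u t) - d_h Om kappa eta bc w (T t) (T t)
       - e_h Om kappa eta bc w (T t))
  (* Ds, Dsigma, Ddiff: discrete material derivatives of s, sigma, sigma - s *)
  (Ds Dsigma Ddiff : R -> broken M)
  (hDs : forall t, t \in `[t0, t1] -> is_Dbar Om q t0 t1 u s t (Ds t))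
  (hDsigma : forall t, t \in `[t0, t1] ->
     is_Dbar Om q t0 t1 u sigma t (Dsigma t))
  (hDdiff : forall t, t \in `[t0, t1] ->
     is_Dbar Om q t0 t1 u (fun t' => subb (sigma t') (s t')) t (Ddiff t))
  (hinternal : forall t, t \in `[t0, t1] -> forall f, DG q f ->
     ip (Ddiff t) f = - d_h Om kappa eta bc cst1 (T t) f) :
  forall t, t \in `[t0, t1] ->
    (forall w, DG 0 w -> nonneg w ->
       (~~ is_hom_neumann bc -> compactly_supported Om w) ->
       ip (Dsigma t) (mulb (T t) w) =
         ip (Ds t) (mulb (T t) w)
           - d_h Om kappa eta bc cst1 (T t) (mulb (T t) w) /\
       0 <= ip (Ds t) (mulb (T t) w)
              - d_h Om kappa eta bc cst1 (T t) (mulb (T t) w)) /\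
    (forall i, (~~ is_hom_neumann bc -> elt i `&` bdry Om = set0) ->
       0 <= integral_on (elt i) (fun x => pval (T t i) x * pval (Dsigma t i) x)).
Proof.
move=> t tI.
have Tq : DG q (T t) by apply: DG_opp; exact: (hT t tI).1.
(* Vanishing on boundary facets follows both from compact support and, for an indicator, from the
   element avoiding the boundary; both conclusions are thus instances. *)
have main w : DG 0 w -> nonneg w ->
    (~~ is_hom_neumann bc -> forall F, boundary_facet Om F ->
       forall x, facet F x -> pval (w F.1) x = 0) ->
    ip (Dsigma t) (mulb (T t) w) =
      ip (Ds t) (mulb (T t) w)
        - d_h Om kappa eta bc cst1 (T t) (mulb (T t) w) /\
    0 <= ip (Ds t) (mulb (T t) w)
           - d_h Om kappa eta bc cst1 (T t) (mulb (T t) w).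
  move=> wq w0 wb; have Twq := DG_mul_DG0 Tq wq.
  have DsE := (hDs t tI).2 _ Twq.
  split.
    have := (hDdiff t tI).2 _ Twq.
    rewrite (hinternal t tI _ Twq) ((hDsigma t tI).2 _ Twq) DsE.
    rewrite (dt_brokenB ht q tI hsigma_smooth hs_smooth) ipBl b_hB => ->.
    exact/esym/addrBACA_KC.
  (* [ip] unfolds to [pair_restr], so orthogonality holds by definition. *)
  have projTw : is_proj q (fun i => pval (mulb (T t) w i)) (mulb (T t) w).
    by split=> // v _; reflexivity.
  (* The quantity to bound is exactly the left-hand side of the entropy equation with [P] equal to
     [mulb (T t) w]. *)
  rewrite DsE (hentropy t tI w (@DG0_leq _ _ _ q _ wq) _ projTw).
  rewrite -addrA -opprD subr_ge0.
  apply: (@le_trans _ _ 0); last exact: c_form_ge0.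
  exact: d_h_add_e_h_le0 (hTpos t tI) wb.
split=> [w wq w0 wc|i ib].
  apply: main => // /wc {}wc F bF x Fx.
  exact: compactly_supported_eq0_bdry wc bF Fx.
have ind0 : nonneg (indicator i) by move=> j x _; rewrite pval_indicator ler0n.
have [|eqD] := main _ (DG0_indicator i) ind0; last first.
  rewrite -eqD ip_mulb_indicator => /le_trans; apply.
  by under eq_integral_on do rewrite mulrC.
(* A boundary facet of element [i] would put its points in [elt i] and in [bdry Om] at once. *)
move=> /ib {}ib F /asboolP bF x Fx.
rewrite pval_indicator; have [Fi|//] := eqVneq F.1 i.
suff : (elt i `&` bdry Om) x by rewrite ib.
by split; [rewrite -Fi; exact: facet_sub_elt|exact: bF].
Qed.
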